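(* Let $G$ be a finite abelian group, $\mathbb{F}$ a field, and $K=\mathbb{F}(\omega)$ an extension of $\mathbb{F}$ generated by an element $\omega$ of multiplicative order $\exp(G)$, with $\Gamma$ the automorphism group of the field extension $K$ of $\mathbb{F}$. Let $M$ be a subset of $\mathcal{B}(\widehat G)$. The polynomial $G$-invariants $\{x^m\mid m\in M\}$ separate the $G$-orbits in the subspace $\mathcal{F}(G,\mathbb{F})$ of $\mathcal{F}(G,K)$ (that is, for any $v,w\in\mathcal{F}(G,\mathbb{F})$ with $G\cdot v\neq G\cdot w$ there is an $m\in M$ with $x^m(v)\neq x^m(w)$) if the following condition holds: for all $\Gamma$-stable subsets $I$ of $\widehat G$ we have $$\langle M_I\rangle_{\mathbb{Z}}\supseteq \mathcal{B}(\widehat G)_I.$$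
   Context: $\exp(G)$ is the least common multiple of the orders of the elements of $G$. The existence of $K$ forces that $\mathrm{char}(\mathbb{F})$ does not divide $|G|$, and $K/\mathbb{F}$ is Galois with group $\Gamma$. $\widehat G$ is the group of homomorphisms $G\to K^\times$ under pointwise multiplication. $\Gamma$ acts on $\widehat G$ by $(\gamma\cdot\chi)(g)=\gamma(\chi(g))$. For a field $L\in\{\mathbb{F},K\}$, $\mathcal{F}(G,L)$ is the $L$-vector space of functions $G\to L$ with $G$-action $(g\cdot f)(h)=f(g^{-1}h)$ (the regular representation). $\Gamma$ acts on $\mathcal{F}(G,K)$ by $(\gamma(f))(g)=\gamma(f(g))$, and $\mathcal{F}(G,\mathbb{F})\subseteq\mathcal{F}(G,K)$ is the set of $\Gamma$-fixed points. $\{f_\psi\mid\psi\in\widehat G\}$ is a fixed $K$-vector space basis of $\mathcal{F}(G,K)$ such that $g\cdot f_\psi=\psi(g)f_\psi$ for all $g\in G$, $\psi\in\widehat G$, and $\gamma(f_\psi)=f_{\gamma\cdot\psi}$ for all $\gamma\in\Gamma$, $\psi\in\widehat G$ (such a basis exists). The dual basis is denoted $\{x_\psi\mid\psi\in\widehat G\}$, so the coordinate ring of $\mathcal{F}(G,K)$ is the polynomial algebra $K[x_\psi\mid\psi\in\widehat G]$. $\mathcal{F}(\widehat G,\mathbb{Z})$ is the abelian group of integer valued functions on $\widehat G$ under pointwise addition, and $\mathcal{B}(\widehat G)$ is the monoid of those functions $m:\widehat G\to\mathbb{Z}_{\geq 0}$ with $\prod_{\psi\in\widehat G}\psi^{m(\psi)}=1_{\widehat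 G}$. For $m\in\mathcal{B}(\widehat G)$, $x^m:=\prod_{\psi\in\widehat G}x_\psi^{m(\psi)}$, which is a $G$-invariant polynomial. For a subset $M\subseteq\mathcal{B}(\widehat G)$ and $I\subseteq\widehat G$, $M_I:=\{m\in M\mid m(\psi)=0\text{ for all }\psi\in\widehat G\setminus I\}$ (in particular this defines $\mathcal{B}(\widehat G)_I$), and $\langle M_I\rangle_{\mathbb{Z}}$ is the $\mathbb{Z}$-submodule of $\mathcal{F}(\widehat G,\mathbb{Z})$ generated by $M_I$. *)

(* Defs.v *)
From HB Require Import structures.
From mathcomp Require Import all_boot all_order all_algebra.
From mathcomp Require Import all_fingroup all_solvable all_field.
From mathcomp Require Import boolp classical_sets.

Set Implicit Arguments.
Unset Strict Implicit.
Unset Printing Implicit Defensive.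

Import GRing.Theory.
Local Open Scope ring_scope.
Local Open Scope classical_set_scope.

Section Dual.
Variables (gT : finGroupType) (K : fieldType).

Definition is_char (chi : {ffun gT -> K}) : bool :=
  [forall g, chi g != 0] &&
  [forall g, forall h, chi (g * h)%g == chi g * chi h].

Record dual := Dual { dual_fun :> {ffun gT -> K}; _ : is_char dual_fun }.

HB.instance Definition _ := [isSub for dual_fun].
HB.instance Definition _ := [Choice of dual by <:].

Lemma dual_neq0 (chi : dual) g : chi g != 0.
Proof. by case: chi => f /= /andP[/forallP]. Qed.

Lemma dualM (chi : dual) g h : chi (g * h)%g = chi g * chi h.
Proof. by case: chi => f /= /andP[_ /forallP/(_ g)/forallP/(_ h)/eqP]. Qed.

Lemma dual1 (chi : dual) : chi 1%g = 1.
Proof. by apply: (mulfI (dual_neq0 chi 1%g)); rewrite -dualM mulg1 mulr1. Qed.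

Lemma dualX (chi : dual) g n : chi (g ^+ n)%g = chi g ^+ n.
Proof.
by elim: n => [|n IHn]; rewrite ?expg0 ?dual1 // expgS dualM IHn exprS.
Qed.

Lemma dual_unity_root (chi : dual) g : #|gT|.-unity_root (chi g).
Proof.
apply/unity_rootP; rewrite -dualX -cardsT.
by rewrite (expg_cardG (G := [set: gT]%G)) ?inE ?dual1.
Qed.

(* The roots of unity in [K] cannot be enumerated constructively, so the
   finiteness of [dual] is obtained classically. *)
Lemma unity_roots_enum n : (0 < n)%N ->
  exists s : seq K, forall z, n.-unity_root z -> z \in s.
Proof.
move=> n_gt0; apply/not_existsP => noS.
have [s [rs us sz]] :
    exists s : seq K, [/\ all n.-unity_root s, uniq s & size s = n.+1].
  elim: n.+1 => [|k [s [rs us sz]]]; first by exists [::].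
  have /existsNP[z /not_implyP[rz zs]] := noS s.
  by exists (z :: s); rewrite /= rz rs us sz; split=> //; rewrite andbT; exact/negP.
by have := max_unity_roots n_gt0 rs us; rewrite sz ltnn.
Qed.

Fact card_group_type_gt0 : (0 < #|gT|)%N.
Proof. by apply/card_gt0P; exists 1%g. Qed.

Let roots : seq K := sval (cid (unity_roots_enum card_group_type_gt0)).

Let rootsP (chi : dual) g : chi g \in roots.
Proof.
by rewrite /roots; case: cid => s /= sP; apply/sP/dual_unity_root.
Qed.

Let dual_enum : seq dual :=
  undup (pmap insub
    [seq [ffun g => ssval (h g)] | h : {ffun gT -> seq_sub roots}]).

Let mem_dual_enum (chi : dual) : chi \in dual_enum.
Proof.
rewrite mem_undup mem_pmap_sub; apply/mapP.
exists [ffun g => SeqSub (rootsP chi g)]; first by rewrite mem_enum.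
by apply/ffunP => g; rewrite !ffunE.
Qed.

Let dual_pickleK : pcancel (fun chi => index chi dual_enum)
                           (fun i => nth None (map Some dual_enum) i).
Proof.
by move=> chi; rewrite (nth_map chi) ?index_mem ?mem_dual_enum // nth_index
  ?mem_dual_enum.
Qed.

HB.instance Definition _ := Choice_isCountable.Build dual dual_pickleK.
HB.instance Definition _ := isFinite.Build dual
  (Finite.uniq_enumP (undup_uniq _) mem_dual_enum).

Fact dual1_is_char : is_char [ffun _ : gT => 1].
Proof.
apply/andP; split; first by apply/forallP => g; rewrite ffunE oner_neq0.
by apply/forallP => g; apply/forallP => h; rewrite !ffunE mulr1.
Qed.

Fact dualM_is_char (chi psi : dual) : is_char [ffun g => chi g * psi g].
Proof.
apply/andP; split.
  by apply/forallP => g; rewrite ffunE mulf_neq0 ?dual_neq0.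
by apply/forallP => g; apply/forallP => h; rewrite !ffunE !dualM mulrACA.
Qed.

Fact dualV_is_char (chi : dual) : is_char [ffun g => (chi g)^-1].
Proof.
apply/andP; split.
  by apply/forallP => g; rewrite ffunE invr_neq0 ?dual_neq0.
by apply/forallP => g; apply/forallP => h; rewrite !ffunE dualM invfM.
Qed.

Definition dual_one : dual := Dual dual1_is_char.
Definition dual_mul (chi psi : dual) : dual := Dual (dualM_is_char chi psi).
Definition dual_inv (chi : dual) : dual := Dual (dualV_is_char chi).

Fact dual_mulA : associative dual_mul.
Proof. by move=> a b c; apply/val_inj/ffunP => g; rewrite !ffunE mulrA. Qed.

Fact dual_mul1 : left_id dual_one dual_mul.
Proof. by move=> a; apply/val_inj/ffunP => g; rewrite !ffunE mul1r. Qed.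

Fact dual_mulV : left_inverse dual_one dual_inv dual_mul.
Proof.
by move=> a; apply/val_inj/ffunP => g; rewrite !ffunE mulVf ?dual_neq0.
Qed.

HB.instance Definition _ :=
  Finite_isGroup.Build dual dual_mulA dual_mul1 dual_mulV.

End Dual.

Record aut_ext (F : fieldType) (K : fieldExtType F) := AutExt {
  aut_fun :> {lrmorphism K -> K};
  aut_bij : bijective aut_fun
}.

Section GaloisAction.
Variables (gT : finGroupType) (F : fieldType) (K : fieldExtType F).

Fact aut_dual_is_char (gamma : aut_ext K) (chi : dual gT K) :
  is_char [ffun g => gamma (chi g)].
Proof.
apply/andP; split.
  by apply/forallP => g; rewrite ffunE fmorph_eq0 dual_neq0.
by apply/forallP => g; apply/forallP => h; rewrite !ffunE dualM rmorphM.
Qed.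

Definition aut_dual (gamma : aut_ext K) (chi : dual gT K) : dual gT K :=
  Dual (aut_dual_is_char gamma chi).

Definition aut_stable (I : {set dual gT K}) : Prop :=
  forall (gamma : aut_ext K) (psi : dual gT K),
    psi \in I -> aut_dual gamma psi \in I.

(* Functions are valued in [K^o] (convertible to [K]) so that [{ffun gT -> K^o}]
   is canonically a vector space over [K], not only over [F]. *)
Definition aut_fct (gamma : aut_ext K) (v : {ffun gT -> K^o}) :
  {ffun gT -> K^o} := [ffun g => gamma (v g)].

Definition fct_incl (v : {ffun gT -> F}) : {ffun gT -> K^o} :=
  [ffun g => (v g)%:A : K].

End GaloisAction.

Definition regular_act (gT : finGroupType) (L : Type) (g : gT)
    (v : {ffun gT -> L}) : {ffun gT -> L} :=
  [ffun h => v (g^-1 * h)%g].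

Definition regular_orbit (gT : finGroupType) (L : Type)
    (v : {ffun gT -> L}) : set {ffun gT -> L} :=
  range (fun g : gT => regular_act g v).

Section Monomials.
Variables (gT : finGroupType) (F : fieldType) (K : fieldExtType F).
Local Notation Ghat := (dual gT K).

Definition adapted_basis (f : Ghat -> {ffun gT -> K^o}) : Prop :=
  [/\ basis_of fullv (codom f),
      forall (g : gT) (psi : Ghat),
        regular_act g (f psi) = (psi g : K) *: f psi
    & forall (gamma : aut_ext K) (psi : Ghat),
        aut_fct gamma (f psi) = f (aut_dual gamma psi)].

Definition dual_coord (f : Ghat -> {ffun gT -> K^o}) (psi : Ghat)
    (v : {ffun gT -> K^o}) : K :=
  coord (codom_tuple f) (enum_rank psi) v.

Definition monomial (f : Ghat -> {ffun gT -> K^o}) (m : {ffun Ghat -> nat})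
    (v : {ffun gT -> K^o}) : K :=
  \prod_(psi : Ghat) dual_coord f psi v ^+ m psi.

End Monomials.

Section ProductOne.
Variable A : finGroupType.

Definition product_one : set {ffun A -> nat} :=
  [set m : {ffun A -> nat} | (\prod_(a : A) a ^+ m a = 1)%g].

Definition supported_in (M : set {ffun A -> nat}) (I : {set A}) :
    set {ffun A -> nat} :=
  [set m : {ffun A -> nat} | M m /\ forall a, a \notin I -> m a = 0%N].

(* [int^o] makes [{ffun A -> int^o}] canonically a module over [int]. *)
Definition fct_int (m : {ffun A -> nat}) : {ffun A -> int^o} :=
  [ffun a => (m a)%:Z].

Definition int_span (S : set {ffun A -> int^o}) : set {ffun A -> int^o} :=
  smallest [set N : set {ffun A -> int^o} | submod_closed (mem N)] S.

End ProductOne.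

Arguments product_one A : clear implicits.
Arguments fct_int {A} m.

(* Main.v *)
(* If all monomials in M agree on v and w, the spanning condition applied to
   the supports (Galois-stable, as v and w are defined over F) shows first that
   v and w have the same support I, since ord(psi) times the indicator function
   of psi is a product-one exponent, and then that the ratios
   c psi = x_psi(w) / x_psi(v) satisfy every multiplicative relation between
   the characters in I.  It remains to find g with psi g = c psi on I, for then
   g v = w.  The relations make c extend to a homomorphism phi on the subgroup
   H generated by I.  If no g exists, then for each g some psi in I has
   psi g <> c psi, and translation by psi shows that the sum over chi in H of
   phi(chi)^-1 chi(g) vanishes.  This contradicts the linear independence of
   the characters. *)
Require Import Defs.
From HB Require Import structures.
From mathcomp Require Import all_boot all_order all_algebra.
From mathcomp Require Import all_fingroup all_solvable all_field.
From mathcomp Require Import ring.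
From mathcomp Require Import boolp classical_sets.

Set Implicit Arguments.
Unset Strict Implicit.
Unset Printing Implicit Defensive.

Import GRing.Theory.
Local Open Scope ring_scope.
Local Open Scope classical_set_scope.

Lemma dual_prodX (gT : finGroupType) (K : fieldType)
    (m : {ffun dual gT K -> nat}) g :
  (\prod_psi psi ^+ m psi)%g g = \prod_(psi : dual gT K) psi g ^+ m psi.
Proof.
have gM : {morph (fun chi : dual gT K => chi g) : x y / (x * y)%g >-> x * y}.
  by move=> x y; rewrite ffunE.
have g1 : (1%g : dual gT K) g = 1 by rewrite ffunE.
rewrite (big_morph (fun chi : dual gT K => chi g) gM g1).
apply: eq_bigr => psi _; elim: (m psi) => // n IHn.
by rewrite expgS gM IHn exprS.
Qed.

(** * Coordinates in an adapted basis and interpolation of character values *)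

Section AdaptedBasis.
Variables (gT : finGroupType) (F : fieldType) (K : fieldExtType F).
Local Notation Ghat := (dual gT K).
Variable f : Ghat -> {ffun gT -> K^o}.
Hypothesis fP : adapted_basis f.

Lemma dual_coord_sum (v : {ffun gT -> K^o}) :
  v = \sum_psi (dual_coord f psi v : K) *: f psi.
Proof.
have [bf _ _] := fP.
have bf' : basis_of fullv (codom_tuple f) := bf.
rewrite [LHS](coord_basis bf' (memvf v)).
rewrite (reindex enum_rank); last by apply: onW_bij; apply: enum_rank_bij.
apply: eq_bigr => psi _; congr (_ *: _).
by rewrite (nth_codom _ _ (enum_rank psi)) enum_rankK.
Qed.

Lemma dual_coord_unique (a : Ghat -> K) psi :
  dual_coord f psi (\sum_(phi : Ghat) a phi *: f phi) = a psi.
Proof.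
have [/andP[_ frf] _ _] := fP.
have -> : \sum_(phi : Ghat) a phi *: f phi =
    \sum_(i < #|{: Ghat}|) a (enum_val i) *: (codom_tuple f)`_i.
  rewrite [RHS](reindex enum_rank); last first.
    by apply: onW_bij; apply: enum_rank_bij.
  apply: eq_bigr => phi _; rewrite enum_rankK; congr (_ *: _).
  by rewrite (nth_codom _ _ (enum_rank phi)) enum_rankK.
by rewrite /dual_coord coord_sum_free ?enum_rankK.
Qed.

Lemma dual_coord_act g psi v :
  dual_coord f psi (regular_act g v) = psi g * dual_coord f psi v.
Proof.
have [_ fact _] := fP.
have -> : regular_act g v =
    \sum_(phi : Ghat) (phi g * dual_coord f phi v : K) *: f phi.
  rewrite {1}(dual_coord_sum v); apply/ffunP => h; rewrite ffunE !sum_ffunE.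
  by apply: eq_bigr => phi _; rewrite mulrC -scalerA -fact !ffunE.
by rewrite dual_coord_unique.
Qed.

(** [gamma] is only semilinear over [K], but it permutes the basis: [aut_dual gamma] is injective on
    a finite type, hence bijective, so the expansion of [v] can be reindexed along it. *)
Lemma dual_coord_aut gamma psi v :
  dual_coord f (aut_dual gamma psi) (aut_fct gamma v) =
    gamma (dual_coord f psi v).
Proof.
have [_ _ faut] := fP.
have inj_aut : injective (@aut_dual gT F K gamma).
  move=> chi phi /(congr1 (@dual_fun _ _))/ffunP eq_chi.
  apply/val_inj/ffunP => g; apply: (fmorph_inj gamma).
  by have := eq_chi g; rewrite !ffunE.
have [aut' autK aut'K] := injF_bij inj_aut.
have -> : aut_fct gamma v =
    \sum_(phi : Ghat) (gamma (dual_coord f (aut' phi) v) : K) *: f phi.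
  rewrite [RHS](reindex (@aut_dual gT F K gamma)); last first.
    by apply: onW_bij; exists aut'.
  rewrite {1}(dual_coord_sum v); apply/ffunP => h; rewrite ffunE !sum_ffunE.
  rewrite rmorph_sum; apply: eq_bigr => phi _.
  by rewrite autK -faut !ffunE rmorphM.
by rewrite dual_coord_unique autK.
Qed.

(** The eigenvector equation gives [f psi h = psi h^-1 * f psi 1], so a zero at [1] would make the
    basis vector [f psi] vanish. *)
Lemma adapted_basis_fct1_neq0 psi : f psi 1%g != 0.
Proof.
have [_ fact _] := fP; apply/eqP => f1.
have f0 : f psi = \sum_(phi : Ghat) (0 : K) *: f phi.
  rewrite big1 => [|phi _]; last by rewrite scale0r.
  apply/ffunP => h; have /ffunP/(_ 1%g) := fact h^-1%g psi.
  by rewrite !ffunE invgK mulg1 f1 => ->; rewrite scaler0.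
have := dual_coord_unique (fun phi => (phi == psi)%:R) psi.
rewrite (bigD1 psi) //= eqxx scale1r big1 => [|phi /negPf->]; last first.
  by rewrite scale0r.
by rewrite addr0 f0 dual_coord_unique => /eqP; rewrite eq_sym oner_eq0.
Qed.

(** Up to the nonzero factor [f phi 1], the basis vector [f phi] is [phi] composed with inversion,
    so independence of the characters is inherited from the basis. *)
Lemma dual_free (a : Ghat -> K) :
  (forall g, \sum_(psi : Ghat) a psi * psi g = 0) -> forall psi, a psi = 0.
Proof.
have [_ fact _] := fP => a0 psi.
pose b phi := a phi / f phi 1%g.
have b0 : \sum_(phi : Ghat) b phi *: f phi = \sum_(phi : Ghat) (0 : K) *: f phi.
  rewrite [RHS]big1 => [|phi _]; last by rewrite scale0r.
  apply/ffunP => h; rewrite sum_ffunE ffunE -[RHS](a0 h^-1%g).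
  apply: eq_bigr => phi _; have /ffunP/(_ 1%g) := fact h^-1%g phi.
  rewrite !ffunE invgK mulg1 => ->.
  rewrite /b /GRing.scale /= mulrAC -mulrA.
  by rewrite mulfK ?adapted_basis_fct1_neq0.
have := congr1 (dual_coord f psi) b0; rewrite !dual_coord_unique => /eqP.
by rewrite mulf_eq0 invr_eq0 (negPf (adapted_basis_fct1_neq0 psi)) orbF => /eqP.
Qed.

(** Its use is to turn ratios of coordinates into a group element that moves one vector to the
    other. *)
Lemma dual_interpolation (I : {set Ghat}) (c : Ghat -> K) :
  (forall psi, psi \in I -> c psi != 0) ->
  (forall m, supported_in (product_one Ghat) I m ->
     \prod_(psi in I) c psi ^+ m psi = 1) ->
  exists g, forall psi, psi \in I -> psi g = c psi.
Proof.
move=> c_neq0 c_rel.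
pose supp (m : {ffun Ghat -> nat}) := forall psi, psi \notin I -> m psi = 0%N.
pose ev (m : {ffun Ghat -> nat}) := (\prod_psi psi ^+ m psi)%g : Ghat.
pose cv (m : {ffun Ghat -> nat}) := \prod_(psi in I) c psi ^+ m psi.
have evE m g : ev m g = \prod_(psi : Ghat) psi g ^+ m psi.
  exact: dual_prodX.
have cvE m : cv m = \prod_(psi in I) c psi ^+ m psi by [].
have cv_neq0 m : cv m != 0.
  by apply/prodf_neq0 => psi Ipsi; rewrite expf_neq0 ?c_neq0.
have ev_card m g : ev m g ^+ #|gT| = 1.
  exact/unity_rootP/dual_unity_root.
have cv1 m : supp m -> (forall g, ev m g = 1) -> cv m = 1.
  move=> sm evm; apply: c_rel; split=> //.
  by apply/val_inj/ffunP => g; rewrite [LHS]evm !ffunE.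
have cv_ev m m' : supp m -> supp m' -> ev m = ev m' -> cv m = cv m'.
  move=> sm sm' ev_mm'.
  have cardS : #|gT|.-1.+1 = #|gT| by rewrite prednK ?card_group_type_gt0.
  (* Natural exponents do not allow [m - m']. As character values are [#|gT|]-th roots of unity,
     [#|gT|.-1] acts as [-1]: both [t] and [t'] are relations, and comparing them cancels a power of
     [cv m']. *)
  pose t := [ffun psi => m psi + m' psi * #|gT|.-1]%N.
  pose t' := [ffun psi => m' psi * #|gT|]%N.
  have cvt : cv t = cv m * cv m' ^+ #|gT|.-1.
    rewrite !cvE -prodrXl -big_split /=; apply: eq_bigr => psi _.
    by rewrite ffunE exprD exprM.
  have cvt' : cv t' = cv m' * cv m' ^+ #|gT|.-1.
    rewrite -exprS cardS !cvE -prodrXl; apply: eq_bigr => psi _.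
    by rewrite ffunE exprM.
  apply: (mulIf (expf_neq0 #|gT|.-1 (cv_neq0 m'))); rewrite -cvt -cvt' !cv1 //.
  - by move=> psi Ipsi; rewrite ffunE sm'.
  - move=> g; rewrite -[RHS](ev_card m' g) !evE -prodrXl.
    apply: eq_bigr => psi _.
    by rewrite ffunE exprM.
  - by move=> psi Ipsi; rewrite ffunE sm ?sm'.
  move=> g; rewrite -[RHS](ev_card m' g) -[in RHS]cardS exprS -{1}ev_mm' !evE.
  rewrite -prodrXl -big_split /=; apply: eq_bigr => psi _.
  by rewrite ffunE exprD exprM.
(* [H] is the subgroup generated by [I]. With [mu] choosing an exponent for each element,
   [cv (mu chi)] is the extension of [c] to [H], independent of the choice by [cv_ev]. *)
pose H (chi : Ghat) : bool := `[< exists2 m, supp m & ev m = chi >].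
have /choice[mu muP] : forall chi, exists m, H chi -> supp m /\ ev m = chi.
  move=> chi; have [/asboolP[m sm evm]|] := boolP (H chi); first by exists m.
  by exists [ffun=> 0%N].
have H_mul chi psi : psi \in I -> H chi ->
    H (chi * psi)%g /\ cv (mu (chi * psi)%g) = cv (mu chi) * c psi.
  move=> Ipsi Hchi; have [s_chi ev_chi] := muP _ Hchi.
  pose m := [ffun phi => mu chi phi + (phi == psi)]%N.
  have sm : supp m.
    move=> phi Iphi; rewrite ffunE s_chi //.
    by case: eqP Iphi => // ->; rewrite Ipsi.
  have evm : ev m = (chi * psi)%g.
    rewrite -{1}ev_chi; apply/val_inj/ffunP => g; rewrite ffunE /= !evE.
    rewrite (bigD1 psi) //= [in RHS](bigD1 psi) //= mulrAC ffunE eqxx.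
    rewrite addn1 exprSr; congr (_ * _); apply: eq_bigr => phi /negPf phi_psi.
    by rewrite ffunE phi_psi addn0.
  have Hm : H (chi * psi)%g by apply/asboolP; exists m.
  split=> //; have [s_mu ev_mu] := muP _ Hm.
  rewrite (cv_ev _ m) // ?ev_mu ?evm // !cvE.
  rewrite (bigD1 psi) //= [in RHS](bigD1 psi) //= mulrAC ffunE eqxx.
  rewrite addn1 exprSr; congr (_ * _).
  apply: eq_bigr => phi /andP[_ /negPf phi_psi]; by rewrite ffunE phi_psi addn0.
have H_mulr chi psi : psi \in I -> H (chi * psi)%g = H chi.
  move=> Ipsi; apply/idP/idP => [Hchi|/(H_mul _ _ Ipsi)[]//].
  (* Division by [psi] is multiplication by its power of exponent [#[psi] - 1], hence finitely many
     steps of [H_mul]. *)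
  have HX k : H (chi * psi * psi ^+ k)%g.
    elim: k => [|k IHk]; first by rewrite expg0 mulg1.
    by rewrite expgSr mulgA; have [] := H_mul _ _ Ipsi IHk.
  by have := HX #[psi]%g.-1; rewrite -invg_expg mulgK.
pose a chi := if H chi then (cv (mu chi))^-1 else 0.
apply: contrapT => no_g.
(* The contradiction appears at the trivial character: it lies in [H] through the zero exponent, so
   its coefficient is the inverse of a nonzero element. *)
have /(_ 1%g) : forall chi, a chi = 0.
  apply: dual_free => g; have /existsNP[psi /not_implyP[Ipsi /eqP psi_c]] :
    ~ forall psi, psi \in I -> psi g = c psi by move=> ?; apply: no_g; exists g.
  set S := \sum_chi _.
  (* Replacing [chi] by [chi * psi] divides the coefficient by [c psi] and multiplies the character
     value by [psi g]. *)
  have S_psi : S * c psi = S * psi g.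
    rewrite {1}/S (reindex_inj (mulIg psi)) !mulr_suml; apply: eq_bigr => chi _.
    rewrite ffunE /= /a H_mulr //; case: ifP => [Hchi|]; last by rewrite !mul0r.
    have [_ ->] := H_mul _ _ Ipsi Hchi.
    by field; rewrite c_neq0 ?cv_neq0.
  by apply: contra_neq_eq psi_c => S_neq0; apply/esym/(mulfI S_neq0).
rewrite /a; case: ifP => [_ /eqP|/negP[]].
  by rewrite invr_eq0 (negPf (cv_neq0 _)).
apply/asboolP; exists [ffun=> 0%N] => [psi _|]; first by rewrite ffunE.
apply/val_inj/ffunP => g.
by rewrite [LHS]evE !ffunE big1 // => psi _; rewrite ffunE.
Qed.
End AdaptedBasis.

(** * Properties inherited by integer spans of exponents *)

Section IntSpan.
Variable A : finGroupType.

Lemma int_span_ind (N S : set {ffun A -> int^o}) :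
  N 0 -> (forall (k : int) s t, N s -> N t -> N (k *: s + t)) ->
  S `<=` N -> int_span S `<=` N.
Proof.
move=> N0 NZD SN t; apply; split=> //; split; first by rewrite inE.
by move=> k s u; rewrite !inE; apply: NZD.
Qed.

(** Since [c] is nonzero on [I], integer powers make sense and [h] maps to the product of the
    [c a ^ h a] homomorphically; the kernel is a submodule. *)
Lemma int_span_prod (K : fieldType) (I : {set A}) (c : A -> K)
    (S : set {ffun A -> nat}) m :
  (forall a, a \in I -> c a != 0) ->
  (forall s, S s -> \prod_(a in I) c a ^+ s a = 1) ->
  int_span (fct_int @` S) (fct_int m) -> \prod_(a in I) c a ^+ m a = 1.
Proof.
move=> c_neq0 S1.
suff: int_span (fct_int @` S) `<=`
    [set h : {ffun A -> int^o} | \prod_(a in I) c a ^ (h a : int) = 1].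
  move=> sub /sub /= prod1; rewrite -[RHS]prod1; apply: eq_bigr => a _.
  by rewrite ffunE.
apply: int_span_ind => [|k s t /= s1 t1|_ [s Ss <-]] /=.
- by rewrite big1 // => a _; rewrite ffunE.
- apply: (@etrans _ _ ((\prod_(a in I) c a ^ (s a : int)) ^ k *
      \prod_(a in I) c a ^ (t a : int))); last by rewrite s1 t1 exp1rz mulr1.
  rewrite (big_morph (fun x => x ^ k) (fun x y => expfzMl x y k) (exp1rz _ k)).
  rewrite -big_split /=; apply: eq_bigr => a Ia.
  rewrite !ffunE expfzDr ?c_neq0 // exprz_exp.
  by congr (_ ^ _ * _); apply: mulrC.
apply: etrans (S1 s Ss); apply: eq_bigr => a _.
by rewrite ffunE.
Qed.

(** Vanishing at [a] survives integer combinations. *)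
Lemma int_span_support (S : set {ffun A -> nat}) m a :
  int_span (fct_int @` S) (fct_int m) -> (0 < m a)%N ->
  exists2 s, S s & (0 < s a)%N.
Proof.
move=> Sm ma; apply: contrapT => noS.
have sub : int_span (fct_int @` S) `<=` [set h : {ffun A -> int^o} | h a = 0].
  apply: int_span_ind => [|k s t /= s0 t0|_ [s Ss <-]] /=.
  - by rewrite ffunE.
  - by rewrite !ffunE s0 t0 scaler0 addr0.
  by rewrite ffunE; have [->|sa] := posnP (s a); [|case: noS; exists s].
by have := sub _ Sm; rewrite /= ffunE => -[ma0]; rewrite ma0 in ma.
Qed.
End IntSpan.

Theorem theorem5p4 (gT : finGroupType) (F : fieldType) (K : fieldExtType F)
    (omega : K) (f : dual gT K -> {ffun gT -> K^o})
    (M : set {ffun dual gT K -> nat}) :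
  abelian [set: gT]%G ->
  (exponent [set: gT]%G).-primitive_root omega ->
  <<1; omega>>%VS = {:K}%VS ->
  adapted_basis f ->
  M `<=` product_one (dual gT K) ->
  (forall I : {set dual gT K}, aut_stable I ->
     fct_int @` supported_in (product_one (dual gT K)) I
       `<=` int_span (fct_int @` supported_in M I)) ->
  forall v w : {ffun gT -> F},
    regular_orbit v <> regular_orbit w ->
    exists2 m, M m &
      monomial f m (fct_incl K v) <> monomial f m (fct_incl K w).
Proof.
move=> _ _ _ fP _ spanM v w orb_vw; apply: contrapT => no_m.
have eqM m : M m -> monomial f m (fct_incl K v) = monomial f m (fct_incl K w).
  by move=> Mm; apply: contrapT => neq; apply: no_m; exists m.
pose x (u : {ffun gT -> F}) psi := dual_coord f psi (fct_incl K u).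
pose I u := finset (fun psi => x u psi != 0).
have I_stable u : aut_stable (I u).
  move=> gamma psi; rewrite !inE.
  (* Being [F]-valued, [u] is fixed by [gamma], so its coordinates at conjugate characters are
     conjugate. *)
  suff -> : x u (aut_dual gamma psi) = gamma (x u psi) by rewrite fmorph_eq0.
  rewrite /x -(dual_coord_aut fP); congr (dual_coord _ _ _).
  by apply/ffunP => g; rewrite !ffunE rmorph_alg.
have monomialE u m J : supported_in M J m ->
    monomial f m (fct_incl K u) = \prod_(psi in J) x u psi ^+ m psi.
  case=> _ mJ; rewrite [RHS]big_mkcond; apply: eq_bigr => psi _.
  by case: ifPn => // /mJ ->; rewrite expr0.
have sub_supp u u' psi :
    (forall m, M m ->
       monomial f m (fct_incl K u) = monomial f m (fct_incl K u')) ->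
    psi \in I u -> psi \in I u'.
  move=> equu' Ipsi.
  pose m := [ffun phi => if phi == psi then #[psi]%g else 0%N].
  have Bm : supported_in (product_one (dual gT K)) (I u) m.
    split=> [|phi]; last by rewrite ffunE; case: eqP => // ->; rewrite Ipsi.
    rewrite /product_one /= big1 // => phi _; rewrite ffunE.
    by case: eqP => [->|_]; rewrite ?expg_order ?expg0.
  have Sm : int_span (fct_int @` supported_in M (I u)) (fct_int m).
    by apply: (spanM _ (I_stable u)); exists m.
  have [|s Ms s_psi] := int_span_support (a := psi) Sm.
    by rewrite ffunE eqxx order_gt0.
  (* As [s] is supported in [I u], its monomial is nonzero at [u], hence at [u']; since [psi] occurs
     in [s], its coordinate at [u'] cannot vanish. *)
  have : monomial f s (fct_incl K u) != 0.
    rewrite (monomialE _ _ _ Ms); apply/prodf_neq0 => phi.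
    by rewrite inE => ?; rewrite expf_neq0.
  rewrite (equu' _ Ms.1) inE; apply: contraNneq => x0.
  rewrite /monomial (bigD1 psi) //= -/(x u' psi) x0.
  by rewrite expr0n gtn_eqF ?mul0r.
have eqI : I v = I w.
  apply/setP => psi; apply/idP/idP; first exact: sub_supp.
  by apply: sub_supp => m /eqM.
(* Outside [I v] the quotient is the default value [0]; [c] is only used on [I v]. *)
pose c psi := x w psi / x v psi.
have xv_neq0 psi : psi \in I v -> x v psi != 0 by rewrite inE.
have c_neq0 psi : psi \in I v -> c psi != 0.
  move=> Ipsi; rewrite mulf_neq0 ?invr_eq0 ?xv_neq0 //.
  by move: Ipsi; rewrite eqI inE.
have cM m : supported_in M (I v) m -> \prod_(psi in I v) c psi ^+ m psi = 1.
  move=> Mm.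
  transitivity (monomial f m (fct_incl K w) / monomial f m (fct_incl K v)).
    rewrite !(monomialE _ _ _ Mm) -prodf_div; apply: eq_bigr => psi _.
    by rewrite expr_div_n.
  rewrite (eqM _ Mm.1) divff // -(eqM _ Mm.1) (monomialE _ _ _ Mm).
  by apply/prodf_neq0 => psi ?; rewrite expf_neq0 ?xv_neq0.
have [|g gP] := dual_interpolation fP c_neq0.
  move=> m Bm; apply: (int_span_prod c_neq0 cM).
  by apply: (spanM _ (I_stable v)); exists m.
have gvw : regular_act g v = w.
  (* Equality is checked over [K], where coordinates exist, and descends because [F] embeds in
     [K]. *)
  suff: fct_incl K (regular_act g v) = fct_incl K w.
    move=> /ffunP eq_incl; apply/ffunP => h; have := eq_incl h.
    by rewrite [LHS]ffunE [RHS]ffunE => /(fmorph_inj (in_alg K)).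
  have -> : fct_incl K (regular_act g v) = regular_act g (fct_incl K v).
    by apply/ffunP => h; rewrite !ffunE.
  rewrite (dual_coord_sum fP (regular_act g _)) [RHS](dual_coord_sum fP).
  apply: eq_bigr => psi _; rewrite (dual_coord_act fP) -/(x v psi) -/(x w psi).
  congr (_ *: _); have [Ipsi|] := boolP (psi \in I v).
    by rewrite (gP _ Ipsi) divfK ?xv_neq0.
  move=> nI; have := nI; rewrite eqI; move: nI; rewrite !inE !negbK.
  by move=> /eqP -> /eqP ->; rewrite mulr0.
apply: orb_vw; rewrite -gvw; apply/seteqP; split=> _ [h _ <-].
  exists (h * g^-1)%g => //; apply/ffunP => k; rewrite !ffunE.
  by rewrite invMg invgK !mulgA mulVg mul1g.
exists (h * g)%g => //; apply/ffunP => k; rewrite !ffunE.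
by rewrite invMg mulgA.
Qed.
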